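(* Let $V$ be a vertex operator algebra and let $J$ be a simple current of $V$. (1) If $M$ is a non-zero $V$-module, then $J\boxtimes M$ is non-zero. (2) If $M$ is an indecomposable $V$-module, then $J\boxtimes M$ is indecomposable. (3) If $M$ is a simple $V$-module, then $J\boxtimes M$ is simple. In particular, $J$ is simple if $V$ is. (4) The covariant functor $J\boxtimes -$ is exact (hence, so is $-\boxtimes J$). (5) If $M$ has a composition series with composition factors $S_i$, $1\le i\le n$, then $J\boxtimes M$ has a composition series with composition factors $J\boxtimes S_i$, $1\le i\le n$. (6) If $M$ has a radical or socle, then so does $J\boxtimes M$. Moreover, the latter radical or socle is then given by $\operatorname{rad}(J\boxtimes M)\cong J\boxtimes\operatorname{rad}M$ or $\operatorname{soc}(J\boxtimes M)\cong J\boxtimes\operatorname{soc}M$, respectively. (7) If $M$ has a radical or socle series, then so does $J\boxtimes M$. In particular, the corresponding Loewy diagrams of $J\boxtimes M$ are obtained by replacing each composition factor $S_i$ of $M$ by $J\boxtimes S_i$.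
   Context: All modules are taken in a category $\mathscr C$ of (grading-restricted generalized) $V$-modules to which the Huang--Lepowsky--Zhang tensor category theory applies; in particular $\mathscr C$ is abelian, closed under the fusion product $\boxtimes$, and is a braided monoidal category under $\boxtimes$ with unit $V$. A grading-restricted generalized module is graded by generalized $L_0$-eigenvalues with finite-dimensional generalized eigenspaces that vanish when the real part of the eigenvalue is sufficiently negative. Fusion product: $W_1\boxtimes W_2$ is a module with a (logarithmic) intertwining operator $\mathcal Y^{\boxtimes}$ of type $\binom{W_1\boxtimes W_2}{W_1\,W_2}$ such that for every module $X$ and intertwining operator $\mathcal Y$ of type $\binom{X}{W_1\,W_2}$ there is a unique morphism $\eta:W_1\boxtimes W_2\to X$ with $\mathcal Y=\eta\circ\mathcal Y^{\boxtimes}$. It is a known fact that fusion is right-exact in each argument. A simple current $J$ of $V$ is a $V$-module that possesses a fusion inverse $J^{-1}$: $J\boxtimes J^{-1}\cong V\cong J^{-1}\boxtimes J$. The radical of a module is the intersection of its maximal proper submodules; the socle is the sum of its simple submodules. Radical (socle) series are the filtrations obtained by iterating the radical (socle); the Loewy diagram records the composition factors of the successive semisimple layers. *)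

(* Defs.v *)
From mathcomp Require Import all_boot all_order all_algebra.
From mathcomp Require Import all_classical all_reals.
From mathcomp.real_closed Require Export complex.

Set Implicit Arguments.
Unset Strict Implicit.
Unset Printing Implicit Defensive.

Import Order.TTheory GRing.Theory Num.Theory.
Local Open Scope classical_set_scope.
Local Open Scope ring_scope.

(* The generalized binomial coefficient [m (m-1) ... (m-i+1) / i!]. *)
Definition zbinom (K : fieldType) (m : int) (i : nat) : K :=
  (\prod_(j < i) (m - j%:Z)%:~R) / (i`!)%:R.

Definition eigen (K : fieldType) (W : lmodType K) (L : W -> W) (z : K) : set W :=
  [set w | L w = z *: w].

Definition gen_eigen (K : fieldType) (W : lmodType K) (L : W -> W) (z : K) :
    set W :=
  [set w | exists m : nat, iter m (fun x => L x - z *: x) w = 0].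

(* [spanned_by P]: every vector is a finite sum of vectors from the [P j].  When
   the [P j] are (generalized) eigenspaces for distinct eigenvalues, the sum of
   the [P j] is automatically direct. *)
Definition spanned_by (I : eqType) (W : zmodType) (P : I -> set W) : Prop :=
  forall w, exists (s : seq I) (u : I -> W),
    [/\ uniq s, (forall j, P j (u j)) & w = \sum_(j <- s) u j].

Definition finite_dim (K : fieldType) (W : lmodType K) (P : set W) : Prop :=
  exists b : seq W, forall w, P w ->
    exists c : nat -> K, w = \sum_(i < size b) c i *: b`_i.

(* A vertex operator [Y(v, x) = \sum_n v_n x^(-n-1)] is given by its modes:
   [act v n w] is [v_n w]. *)

Definition truncated (V W : zmodType) (act : V -> int -> W -> W) : Prop :=
  forall v w, exists N : int, forall n, N <= n -> act v n w = 0.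

(* The Jacobi identity, read off coefficientwise (Borcherds' identity).  The
   sums have finite support as soon as [mode] and [act] are [truncated]. *)
Definition jacobi (K : fieldType) (V W : lmodType K)
    (mode : V -> int -> V -> V) (act : V -> int -> W -> W) : Prop :=
  forall (u v : V) (w : W) (l m n : int),
    \sum_(i \in [set: nat])
       zbinom K m i *: act (mode u (l + i%:Z) v) (m + n - i%:Z) w =
    \sum_(i \in [set: nat]) ((-1) ^+ i * zbinom K l i) *:
       (act u (m + l - i%:Z) (act v (n + i%:Z) w)
        - (-1) ^ l *: act v (n + l - i%:Z) (act u (m + i%:Z) w)).

Record voa (R : realType) := Voa {
  voa_sort :> lmodType R[i];
  mode : voa_sort -> int -> voa_sort -> voa_sort;
  vac : voa_sort;
  omega : voa_sort;
  central_charge : R[i];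
  mode_linl : forall n w, linear (fun v => mode v n w);
  mode_linr : forall v n, linear (mode v n);
  mode_trunc : truncated mode;
  mode_vac : forall n v, mode vac n v = if n == -1 then v else 0;
  creation : forall v, mode v (-1) vac = v;
  creation_ge0 : forall v (n : int), 0 <= n -> mode v n vac = 0;
  mode_jacobi : jacobi mode mode;
  (* [L_n] is the mode [omega_(n+1)] *)
  virasoro : forall (m n : int) v,
    mode omega (m + 1) (mode omega (n + 1) v)
      - mode omega (n + 1) (mode omega (m + 1) v) =
    (m - n)%:~R *: mode omega (m + n + 1) v
      + (if m + n == 0 then ((m ^+ 3 - m)%:~R / 12%:R * central_charge) *: v
         else 0);
  mode_deriv : forall v n w,
    mode (mode omega 0 v) n w = - n%:~R *: mode v (n - 1) w;
  voa_graded : spanned_by (fun j : int => eigen (mode omega 1) j%:~R);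
  voa_fin : forall j : int, finite_dim (eigen (mode omega 1) j%:~R);
  voa_bounded : exists N : int, forall j : int, j < N ->
    eigen (mode omega 1) j%:~R `<=` [set 0];
  vac_deg : eigen (mode omega 1) 0 vac;
  omega_deg : eigen (mode omega 1) 2%:R omega }.

Record vmodule (R : realType) (V : voa R) := VModule {
  vmodule_sort :> lmodType R[i];
  act : V -> int -> vmodule_sort -> vmodule_sort;
  act_linl : forall n w, linear (fun v => act v n w);
  act_linr : forall v n, linear (act v n);
  act_trunc : truncated act;
  act_vac : forall n w, act (vac V) n w = if n == -1 then w else 0;
  act_jacobi : jacobi (@mode R V) act;
  act_deriv : forall v n w,
    act (mode (omega V) 0 v) n w = - n%:~R *: act v (n - 1) w;
  vmodule_graded : spanned_by (gen_eigen (act (omega V) 1));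
  vmodule_fin : forall z, finite_dim (gen_eigen (act (omega V) 1) z);
  vmodule_bounded : exists r : R, forall z : R[i], complex.Re z < r ->
    gen_eigen (act (omega V) 1) z `<=` [set 0] }.

Record vhom (R : realType) (V : voa R) (W1 W2 : vmodule V) := VHom {
  vhom_fun :> {linear W1 -> W2};
  vhom_act : forall v n w, vhom_fun (act v n w) = act v n (vhom_fun w) }.

Section AdjointModule.
Variables (R : realType) (V : voa R).

Let L0 : V -> V := mode (omega V) 1.

Let L0_lin : linear L0. Proof. exact: mode_linr. Qed.

Let L0D x y : L0 (x + y) = L0 x + L0 y.
Proof. by have := L0_lin 1 x y; rewrite !scale1r. Qed.

Let L0_0 : L0 0 = 0.
Proof. by have := L0_lin (-1) 0 0; rewrite scaler0 addr0 scaleN1r addNr. Qed.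

Let L0Z a x : L0 (a *: x) = a *: L0 x.
Proof. by have := L0_lin a x 0; rewrite L0_0 !addr0. Qed.

Let L0_sum (s : seq int) (u : int -> V) :
  L0 (\sum_(j <- s) u j) = \sum_(j <- s) L0 (u j).
Proof. by elim/big_rec2: _ => [//|j x y _ <-]; rewrite L0D. Qed.

Let shift_eigen_sum (s : seq int) (u : int -> V) z :
  (forall j, eigen L0 j%:~R (u j)) ->
  L0 (\sum_(j <- s) u j) - z *: (\sum_(j <- s) u j) =
  \sum_(j <- s) (j%:~R - z) *: u j.
Proof.
move=> hu; rewrite L0_sum scaler_sumr -sumrB; apply: eq_bigr => j _.
by rewrite (hu j : L0 (u j) = _) scalerBl.
Qed.

Let eigenZ (u : int -> V) (a : int -> R[i]) :
  (forall j, eigen L0 j%:~R (u j)) ->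
  forall j, eigen L0 j%:~R (a j *: u j).
Proof. by move=> hu j; rewrite /eigen /= L0Z (hu j : L0 (u j) = _) !scalerA mulrC. Qed.

Let eigen_free (s : seq int) (u : int -> V) : uniq s ->
  (forall j, eigen L0 j%:~R (u j)) -> \sum_(j <- s) u j = 0 ->
  forall j, j \in s -> u j = 0.
Proof.
elim: s u => [//|j0 s IH] u /= /andP[j0s us] hu s0.
have tail0 j : j \in s -> u j = 0.
  move=> js; have := shift_eigen_sum (j0 :: s) j0%:~R hu.
  rewrite s0 L0_0 scaler0 subr0 big_cons subrr scale0r add0r => /esym.
  move=> /(IH _ us (eigenZ _ hu)) /(_ _ js) /eqP.
  rewrite scaler_eq0 -intrB intr_eq0 subr_eq0 => /orP[/eqP jj0|/eqP//].
  by rewrite -jj0 js in j0s.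
move=> j; rewrite in_cons => /orP[/eqP->|]; last exact: tail0.
by move: s0; rewrite big_cons big_seq big1 ?addr0.
Qed.

Let gen_eigenP z w : gen_eigen L0 z w ->
  w = 0 \/ exists j : int, z = j%:~R /\ eigen L0 j%:~R w.
Proof.
move=> [m]; have [s [u [us hu ->]]] := voa_graded w.
have -> : iter m (fun x => L0 x - z *: x) (\sum_(j <- s) u j) =
    \sum_(j <- s) (j%:~R - z) ^+ m *: u j.
  elim: m => [|m IH] /=; first by apply: eq_bigr => j _; rewrite scale1r.
  rewrite IH shift_eigen_sum; last exact: eigenZ.
  by apply: eq_bigr => j _; rewrite scalerA exprS.
move=> /(eigen_free us (eigenZ _ hu)) h0.
have {}h0 j : j \in s -> u j = 0 \/ z = j%:~R.
  move=> /h0 /eqP; rewrite scaler_eq0 => /orP[|/eqP]; last by left.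
  by rewrite expf_eq0 subr_eq0 => /andP[_ /eqP ->]; right.
have [[j js jz]|nz] := pselect (exists2 j, j \in s & z = j%:~R); last first.
  left; rewrite big_seq big1 // => j js.
  by have [//|zj] := h0 j js; case: nz; exists j.
right; exists j; split=> //.
rewrite (bigD1_seq j) //= big_seq_cond big1 ?addr0; first exact: hu.
move=> k /andP[ks kj]; have [//|zk] := h0 k ks.
by move: kj; rewrite -(eqr_int R[i]) -zk -jz eqxx.
Qed.

Let adjoint_graded : spanned_by (gen_eigen L0).
Proof.
move=> w; have [s [u [us hu ->]]] := voa_graded w.
exists [seq j%:~R | j <- s], (fun z => \sum_(j <- s | j%:~R == z) u j); split.
- by rewrite map_inj_uniq //; exact: intr_inj.
- move=> z; exists 1%N => /=; apply/eqP; rewrite subr_eq0; apply/eqP.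
  elim/big_rec: _ => [|j x /eqP <- hx]; first by rewrite L0_0 scaler0.
  by rewrite L0D hx (hu j : L0 (u j) = _) scalerDr.
rewrite big_map big_seq [RHS]big_seq; apply: eq_bigr => j js.
rewrite (eq_bigl (pred1 j)); last by move=> k /=; rewrite eqr_int.
by rewrite -big_filter filter_pred1_uniq // big_seq1.
Qed.

Let adjoint_fin z : finite_dim (gen_eigen L0 z).
Proof.
have [[j ->]|nz] := pselect (exists j : int, z = j%:~R).
  have [b hb] := voa_fin V j; exists b => w /gen_eigenP[->|[k [/eqP]]].
    exists (fun=> 0); rewrite big1 // => i _; exact: scale0r.
  by rewrite eqr_int => /eqP <-; exact: hb.
exists [::] => w /gen_eigenP[->|[j [zj _]]]; last by case: nz; exists j.
by exists (fun=> 0); rewrite big_ord0.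
Qed.

Let adjoint_bounded : exists r : R, forall z : R[i], complex.Re z < r ->
  gen_eigen L0 z `<=` [set 0].
Proof.
have [N hN] := voa_bounded V; exists N%:~R => z zN w /gen_eigenP[//|[j [zj]]].
apply: hN; move: zN; rewrite zj.
have -> : (j%:~R : R[i]) = (j%:~R : R)%:C%C by rewrite rmorph_int.
by rewrite /= ltr_int.
Qed.

Definition adjoint : vmodule V :=
  VModule (@mode_linl R V) (@mode_linr R V) (@mode_trunc R V)
    (@mode_vac R V) (@mode_jacobi R V) (@mode_deriv R V)
    adjoint_graded adjoint_fin adjoint_bounded.

End AdjointModule.

(* [Y(w1, x) w2 = \sum_(n in C) \sum_(k in nat) (w1)_(n;k) w2 x^(-n-1) (log x)^k],
   where [opr w1 n k w2] is [(w1)_(n;k) w2]. *)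
Record intertwiner (R : realType) (V : voa R) (W1 W2 W3 : vmodule V) :=
  Intertwiner {
  opr :> W1 -> R[i] -> nat -> W2 -> W3;
  opr_linl : forall n k w2, linear (fun w1 => opr w1 n k w2);
  opr_linr : forall w1 n k, linear (opr w1 n k);
  (* each power of [x] is multiplied by a polynomial in [log x] *)
  opr_log : forall w1 w2 n, exists K : nat, forall k, (K <= k)%N ->
    opr w1 n k w2 = 0;
  opr_trunc : forall w1 w2 n, exists N : nat, forall m k, (N <= m)%N ->
    opr w1 (n + m%:R) k w2 = 0;
  opr_jacobi : forall (v : V) w1 w2 (l m : int) (n : R[i]) (k : nat),
    \sum_(i \in [set: nat])
       zbinom _ m i *: opr (act v (l + i%:Z) w1) (m%:~R + n - i%:R) k w2 =
    \sum_(i \in [set: nat]) ((-1) ^+ i * zbinom _ l i) *: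
       (act v (m + l - i%:Z) (opr w1 (n + i%:R) k w2)
        - (-1) ^ l *: opr w1 (n + l%:~R - i%:R) k (act v (m + i%:Z) w2));
  (* [Y(L_(-1) w1, x) = d/dx Y(w1, x)] *)
  opr_deriv : forall w1 w2 n k,
    opr (act (omega V) 0 w1) n k w2 =
    - n *: opr w1 (n - 1) k w2 + k.+1%:R *: opr w1 (n - 1) k.+1 w2 }.

Section Precomposition.
Variables (R : realType) (V : voa R) (W1 W2 W1' W2' W3 : vmodule V).
Variables (f : vhom W1 W1') (g : vhom W2 W2') (Y : intertwiner W1' W2' W3).

Let Yfg w1 n k w2 := Y (f w1) n k (g w2).

Let Yfg_linl n k w2 : linear (fun w1 => Yfg w1 n k w2).
Proof. by move=> a x y; rewrite /Yfg linearP (opr_linl Y). Qed.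

Let Yfg_linr w1 n k : linear (Yfg w1 n k).
Proof. by move=> a x y; rewrite /Yfg linearP (opr_linr Y). Qed.

Let Yfg_log w1 w2 n : exists K : nat, forall k, (K <= k)%N -> Yfg w1 n k w2 = 0.
Proof. exact: opr_log. Qed.

Let Yfg_trunc w1 w2 n : exists N : nat, forall m k, (N <= m)%N ->
  Yfg w1 (n + m%:R) k w2 = 0.
Proof. exact: opr_trunc. Qed.

Let Yfg_jacobi (v : V) w1 w2 (l m : int) (n : R[i]) (k : nat) :
  \sum_(i \in [set: nat])
     zbinom _ m i *: Yfg (act v (l + i%:Z) w1) (m%:~R + n - i%:R) k w2 =
  \sum_(i \in [set: nat]) ((-1) ^+ i * zbinom _ l i) *:
     (act v (m + l - i%:Z) (Yfg w1 (n + i%:R) k w2)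
      - (-1) ^ l *: Yfg w1 (n + l%:~R - i%:R) k (act v (m + i%:Z) w2)).
Proof.
have := opr_jacobi Y v (f w1) (g w2) l m n k.
rewrite (eq_fsbigr (fun i : nat => zbinom _ m i *:
  Yfg (act v (l + i%:Z) w1) (m%:~R + n - i%:R) k w2)) => [->|i _]; last first.
  by rewrite /Yfg vhom_act.
by apply: eq_fsbigr => i _; rewrite /Yfg vhom_act.
Qed.

Let Yfg_deriv w1 w2 n k :
  Yfg (act (omega V) 0 w1) n k w2 =
  - n *: Yfg w1 (n - 1) k w2 + k.+1%:R *: Yfg w1 (n - 1) k.+1 w2.
Proof. by rewrite /Yfg vhom_act opr_deriv. Qed.

(* [Y(f -, x) (g -)] *)
Definition precomp : intertwiner W1 W2 W3 :=
  Intertwiner Yfg_linl Yfg_linr Yfg_log Yfg_trunc Yfg_jacobi Yfg_deriv.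

End Precomposition.

Section FullSubcategory.
Variables (R : realType) (V : voa R) (inC : vmodule V -> Prop).

Record object := Object { object_mod :> vmodule V; objectP : inC object_mod }.

(* A bijective homomorphism has a homomorphism as inverse. *)
Definition isomorphic (M N : vmodule V) : Prop :=
  exists f : vhom M N, bijective f.

Definition is_direct_sum2 (A B M : vmodule V) : Prop :=
  exists (f : vhom A M) (g : vhom B M),
    bijective (fun ab : A * B => f ab.1 + g ab.2).

(* Abelian, with the kernels, cokernels and direct sums of vector spaces. *)
Record abelian_subcategory : Prop := AbelianSubcategory {
  has_zero : exists Z : object, forall z : Z, z = 0;
  has_direct_sum2 : forall A B : object,
    exists M : object, is_direct_sum2 A B M;
  has_kernel : forall (A B : object) (f : vhom A B),
    exists (K : object) (i : vhom K A),
      injective i /\ range i = [set x | f x = 0];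
  has_cokernel : forall (A B : object) (f : vhom A B),
    exists (Q : object) (q : vhom B Q),
      range q = setT /\ [set x | q x = 0] = range f }.

Record fusion_product := FusionProduct {
  fus : object -> object -> object;
  fusY : forall A B : object, intertwiner A B (fus A B);
  fus_lift : forall A B X : object, intertwiner A B X -> vhom (fus A B) X;
  fus_liftE : forall (A B X : object) (Y : intertwiner A B X) a n k b,
    fus_lift Y (fusY A B a n k b) = Y a n k b;
  fus_lift_uniq : forall (A B X : object) (Y : intertwiner A B X)
      (h : vhom (fus A B) X),
    (forall a n k b, h (fusY A B a n k b) = Y a n k b) -> h =1 fus_lift Y }.

Definition fus_map (F : fusion_product) (A B A' B' : object)
    (f : vhom A A') (g : vhom B B') : vhom (fus F A B) (fus F A' B') :=
  fus_lift F (precomp f g (fusY F A' B')).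

Definition vhom_id_act (M : vmodule V) v n (w : M) :
  (idfun : {linear M -> M}) (act v n w) = act v n (idfun w) := erefl.
Definition vhom_id (M : vmodule V) : vhom M M := VHom (@vhom_id_act M).

Local Notation "A ** B" := (fus _ A B) (at level 40, left associativity).
Local Notation id := (vhom_id _).

Record braided_monoidal (F : fusion_product) (unit : object) := Braided {
  assoc : forall A B D : object, vhom (fus F (fus F A B) D) (fus F A (fus F B D));
  lunit : forall A : object, vhom (fus F unit A) A;
  runit : forall A : object, vhom (fus F A unit) A;
  braid : forall A B : object, vhom (fus F A B) (fus F B A);
  assocV : forall A B D : object,
    vhom (fus F A (fus F B D)) (fus F (fus F A B) D);
  assocK : forall A B D, cancel (assoc A B D) (assocV A B D);
  assocVK : forall A B D, cancel (assocV A B D) (assoc A B D);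
  lunit_iso : forall A, bijective (lunit A);
  runit_iso : forall A, bijective (runit A);
  braid_iso : forall A B, bijective (braid A B);
  assoc_nat : forall (A B D A' B' D' : object)
      (f : vhom A A') (g : vhom B B') (h : vhom D D'),
    assoc A' B' D' \o fus_map F (fus_map F f g) h =1
    fus_map F f (fus_map F g h) \o assoc A B D;
  lunit_nat : forall (A B : object) (f : vhom A B),
    lunit B \o fus_map F id f =1 f \o lunit A;
  runit_nat : forall (A B : object) (f : vhom A B),
    runit B \o fus_map F f id =1 f \o runit A;
  braid_nat : forall (A B A' B' : object) (f : vhom A A') (g : vhom B B'),
    braid A' B' \o fus_map F f g =1 fus_map F g f \o braid A B;
  pentagon : forall A B D E : object,
    assoc A B (D ** E) \o assoc (A ** B) D E =1
    fus_map F id (assoc B D E) \o assoc A (B ** D) E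
      \o fus_map F (assoc A B D) id;
  triangle : forall A B : object,
    fus_map F id (lunit B) \o assoc A unit B =1 fus_map F (runit A) id;
  hexagon : forall A B D : object,
    assoc B D A \o braid A (B ** D) \o assoc A B D =1
    fus_map F id (braid A D) \o assoc B A D \o fus_map F (braid A B) id;
  hexagonV : forall A B D : object,
    assocV D A B \o braid (A ** B) D \o assocV A B D =1
    fus_map F (braid A D) id \o assocV A D B \o fus_map F id (braid B D) }.

End FullSubcategory.

(* The convergence and extension conditions of the Huang-Lepowsky-Zhang theory
   are not recorded, only its conclusions; the coherence isomorphisms may be any
   that satisfy the axioms. *)
Record module_category (R : realType) (V : voa R) := ModuleCategory {
  in_category :> vmodule V -> Prop;
  category_abelian : abelian_subcategory in_category;
  category_fusion : fusion_product in_category;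
  category_unit : in_category (adjoint V);
  category_braided : braided_monoidal category_fusion (Object category_unit) }.

Definition unit_object (R : realType) (V : voa R) (C : module_category V) :
  object C := Object (category_unit C).

Definition fusion (R : realType) (V : voa R) (C : module_category V)
  (A B : object C) : object C := fus (category_fusion C) A B.

Notation "A ⊠ B" := (fusion A B) (at level 40, left associativity).

Definition fusion_map (R : realType) (V : voa R) (C : module_category V)
    (A B A' B' : object C) (f : vhom A A') (g : vhom B B') :
    vhom (A ⊠ B) (A' ⊠ B') :=
  fus_map (category_fusion C) f g.

Definition simple_current (R : realType) (V : voa R) (C : module_category V)
    (J : object C) : Prop :=
  exists J' : object C, isomorphic (J ⊠ J') (unit_object C) /\
                        isomorphic (unit_object C) (J' ⊠ J).

(* All notions below are internal to the category: a submodule of an object [M]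
   means a submodule of [M] that belongs to the category. *)

Section Submodules.
Variables (R : realType) (V : voa R) (C : vmodule V -> Prop).
Implicit Types M N A B L : object C.

Definition nonzero (M : vmodule V) : Prop := exists x : M, x <> 0.

(* [i] identifies [N] with the subset [P] of [M] *)
Definition identifies N M (i : vhom N M) (P : set M) : Prop :=
  injective i /\ range i = P.

Definition submodule M (P : set M) : Prop :=
  exists N (i : vhom N M), identifies i P.

Definition simple M : Prop :=
  nonzero M /\ forall P : set M, submodule P -> P = [set 0] \/ P = setT.

Definition indecomposable M : Prop :=
  nonzero M /\ forall A B, is_direct_sum2 A B M -> ~ nonzero A \/ ~ nonzero B.

Definition short_exact A B D (f : vhom A B) (g : vhom B D) : Prop :=
  [/\ injective f, range f = [set y | g y = 0] & range g = setT].

Definition maximal_submodule M (P : set M) : Prop :=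
  [/\ submodule P, P <> setT &
      forall Q, submodule Q -> P `<=` Q -> Q = P \/ Q = setT].

Definition simple_submodule M (P : set M) : Prop :=
  exists N (i : vhom N M), simple N /\ identifies i P.

(* The intersection of the maximal proper submodules, in the lattice of
   submodules (that is, the largest submodule contained in all of them), so [M] itself if
   there are none.  See [radicalE] below. *)
Definition radical M (P : set M) : Prop :=
  [/\ submodule P, (forall Q, maximal_submodule Q -> P `<=` Q) &
      forall P', submodule P' ->
        (forall Q, maximal_submodule Q -> P' `<=` Q) -> P' `<=` P].

(* The sum of the simple submodules, in the lattice of submodules (that is, the
   smallest submodule containing all of them).  See [socleE] below. *)
Definition socle M (P : set M) : Prop :=
  [/\ submodule P, (forall Q, simple_submodule Q -> Q `<=` P) &
      forall P', submodule P' ->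
        (forall Q, simple_submodule Q -> Q `<=` P') -> P `<=` P'].

Definition is_radical M N : Prop :=
  exists (P : set M) (i : vhom N M), radical P /\ identifies i P.

Definition is_socle M N : Prop :=
  exists (P : set M) (i : vhom N M), socle P /\ identifies i P.

(* [L] is the quotient [Q / P] of two submodules of [M]. *)
Definition subquotient M (P Q : set M) L : Prop :=
  submodule P /\ P `<=` Q /\
  exists N (i : vhom N M) (q : vhom N L),
    [/\ identifies i Q, range q = setT & forall x, q x = 0 <-> P (i x)].

Definition composition_series M (n : nat) (S : 'I_n -> object C) : Prop :=
  (forall i, simple (S i)) /\
  exists F : nat -> set M,
    [/\ F 0 = [set 0], F n = setT &
        forall i : 'I_n, subquotient (F i) (F i.+1) (S i)].

(* [F 0 = M] and [F (k+1) = rad (F k)].  The series need not reach [0]; if it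
   does, it is constant from there on. *)
Definition radical_series M (F : nat -> set M) : Prop :=
  F 0 = setT /\
  forall k, exists N (i : vhom N M) (P : set N),
    [/\ identifies i (F k), radical P & F k.+1 = i @` P].

(* [F 0 = 0] and [F (k+1) / F k = soc (M / F k)] *)
Definition socle_series M (F : nat -> set M) : Prop :=
  F 0 = [set 0] /\
  forall k, exists (Q : object C) (q : vhom M Q) (P : set Q),
    [/\ range q = setT, [set x | q x = 0] = F k, socle P & F k.+1 = q @^-1` P].

(* Direct sum in the category of a possibly infinite family. *)
Definition is_direct_sum (I : Type) (S : I -> object C) M : Prop :=
  exists f : forall i, vhom (S i) M,
    forall (X : object C) (g : forall i, vhom (S i) X),
    exists h : vhom M X, (forall i, h \o f i =1 g i) /\
      forall h' : vhom M X, (forall i, h' \o f i =1 g i) -> h' =1 h.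

(* [Q / P] is semisimple with composition factors [S]. *)
Definition semisimple_layer M (P Q : set M) (I : Type) (S : I -> object C) :
    Prop :=
  (forall i, simple (S i)) /\
  exists L, subquotient P Q L /\ is_direct_sum S L.

(* The Loewy diagram of a series is the family [D], [D k] being the family of
   composition factors of the [k]-th layer. *)
Definition radical_loewy_diagram M (F : nat -> set M) (I : nat -> Type)
    (D : forall k, I k -> object C) : Prop :=
  forall k, semisimple_layer (F k.+1) (F k) (D k).

Definition socle_loewy_diagram M (F : nat -> set M) (I : nat -> Type)
    (D : forall k, I k -> object C) : Prop :=
  forall k, semisimple_layer (F k) (F k.+1) (D k).

Definition stable (W : vmodule V) (P : set W) : Prop :=
  [/\ P 0, (forall a x y, P x -> P y -> P (a *: x + y)) &
      forall v n x, P x -> P (act v n x)].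

Definition closed_under_submodules : Prop :=
  forall M (P : set M), stable P -> submodule P.

Lemma submodule_stable M (P : set M) : submodule P -> stable P.
Proof.
move=> [N [i [_ <-]]]; split; first by exists 0; rewrite ?linear0.
- by move=> a _ _ [x _ <-] [y _ <-]; exists (a *: x + y); rewrite ?linearP.
- by move=> v n _ [x _ <-]; exists (act v n x); rewrite ?vhom_act.
Qed.

Lemma radicalE M (P : set M) : closed_under_submodules ->
  radical P <-> P = \bigcap_(Q in @maximal_submodule M) Q.
Proof.
move=> Csub; set B := \bigcap_(_ in _) _.
have sB : submodule B.
  apply: Csub; split.
  - by move=> Q [/submodule_stable[]].
  - move=> a x y hx hy Q mQ; have [/submodule_stable[_ h _] _ _] := mQ.
    by apply: h; [exact: hx|exact: hy].
  - move=> v n x hx Q mQ; have [/submodule_stable[_ _ h] _ _] := mQ.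
    by apply: h; exact: hx.
split=> [[_ lP gP]|->].
  apply/seteqP; split=> x Px; first by move=> Q /lP; apply.
  by apply: (gP B) => // Q mQ y; apply.
split=> // [Q mQ x|P' _ h x P'x Q mQ]; first by apply.
exact: (h Q mQ).
Qed.

Lemma socleE M (P : set M) : closed_under_submodules ->
  socle P <-> P = [set x | exists s : seq M,
    (forall y, y \in s -> exists2 Q, simple_submodule Q & Q y) /\
    x = \sum_(y <- s) y].
Proof.
move=> Csub; set B := [set x | _].
have sub_simple Q : simple_submodule Q -> stable Q.
  by move=> [N [i [_ iQ]]]; apply: submodule_stable; exists N, i.
have map_sum (h : M -> M) : linear h ->
    (forall Q, simple_submodule Q -> forall y, Q y -> Q (h y)) ->
    forall x, B x -> B (h x).
  move=> hP hQ _ [s [hs ->]]; exists [seq h y | y <- s]; split.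
    by move=> _ /mapP[y /hs[Q sQ Qy] ->]; exists Q => //; exact: hQ.
  have hD x y : h (x + y) = h x + h y by have := hP 1 x y; rewrite !scale1r.
  have h0 : h 0 = 0.
    by have := hP (-1) 0 0; rewrite scaler0 addr0 scaleN1r addNr.
  by rewrite big_map; elim/big_rec2: _ => [//|i x y _ <-]; rewrite hD.
have sB : submodule B.
  apply: Csub; split; first by exists [::]; rewrite big_nil.
  - move=> a x y /(map_sum ( *:%R a)) [].
    + by move=> b u v; rewrite scalerDr !scalerA mulrC.
    + move=> Q sQ u Qu; have [Q0 /(_ a _ _ Qu Q0) + _] := sub_simple _ _ sQ.
      by rewrite addr0.
    move=> s [hs ->] [t [ht ->]]; exists (s ++ t); rewrite big_cat; split=> // z.
    by rewrite mem_cat => /orP[/hs|/ht].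
  - move=> v n; apply: map_sum; first exact: act_linr.
    by move=> Q /sub_simple[_ _ h] x; exact: h.
have simpleB Q : simple_submodule Q -> Q `<=` B.
  move=> sQ x Qx; exists [:: x]; rewrite big_seq1; split=> // y.
  by rewrite inE => /eqP ->; exists Q.
have leB P' : submodule P' -> (forall Q, simple_submodule Q -> Q `<=` P') ->
    B `<=` P'.
  move=> /submodule_stable[P0 PD _] h _ [s [hs ->]].
  rewrite big_seq; elim/big_rec: _ => [//|y x /hs[Q sQ Qy] Px].
  by rewrite -[y]scale1r; apply: PD => //; exact: (h Q).
split=> [[sP gP lP]|->]; last by [].
by apply/seteqP; split; [exact: lP|exact: leB].
Qed.

End Submodules.

(* Main.v *)
From HB Require Import structures.
Require Import Defs.
From mathcomp Require Import all_boot all_order all_algebra.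
From mathcomp Require Import all_classical all_reals.
Import Order.TTheory GRing.Theory Num.Theory.
Local Open Scope classical_set_scope.
Local Open Scope ring_scope.

Set Implicit Arguments.
Unset Strict Implicit.
Unset Printing Implicit Defensive.

(* If [J'] is a fusion inverse of [J], the associativity and unit isomorphisms
   give natural isomorphisms [J' ⊠ (J ⊠ A) ≅ A ≅ J ⊠ (J' ⊠ A)], so [J ⊠ -] is an
   additive autoequivalence of the category.  As kernels and cokernels are those
   of vector spaces, injective means monic and surjective means epic, so an
   autoequivalence [F] preserves and reflects both, and [range i |-> range (F i)]
   is an isomorphism from the lattice of submodules of [M] to that of [F M].
   Everything in the statement is expressed in terms of this lattice,
   subquotients and direct sums.  Exactness of [- ⊠ J] follows by braiding. *)

Lemma bij_surj (aT rT : Type) (f : aT -> rT) : bijective f -> range f = setT.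
Proof. by move=> [g _ gK]; apply/seteqP; split=> // y _; exists (g y). Qed.

(** * Homomorphisms of modules, factorizations and binary direct sums *)

Section Homomorphisms.
Variables (R : realType) (V : voa R).
Implicit Types A B D M N : vmodule V.

Definition vhom_of A B (f : A -> B) (linf : linear f)
    (actf : forall v n w, f (act v n w) = act v n (f w)) : vhom A B :=
  @VHom _ _ _ _ (HB.pack_for {linear A -> B} f
    (GRing.isLinear.Build _ _ _ _ f linf)) actf.

Definition vhom_comp A B D (g : vhom B D) (f : vhom A B) : vhom A D.
Proof.
apply: (@vhom_of A D (g \o f)) => [a x y|v n w] /=; first by rewrite !linearP.
by rewrite !vhom_act.
Defined.

Lemma act0 M (v : V) n : act v n (0 : M) = 0.
Proof.
have := act_linr v n (-1) (0 : M) 0.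
by rewrite scaler0 addr0 scaleN1r addNr.
Qed.

Lemma actD M (v : V) n (x y : M) : act v n (x + y) = act v n x + act v n y.
Proof. by have := act_linr v n 1 x y; rewrite !scale1r. Qed.

Definition vhom_zero A B : vhom A B.
Proof.
apply: (@vhom_of A B (fun=> 0)) => [a x y|v n w] /=; last by rewrite act0.
by rewrite scaler0 addr0.
Defined.

Definition vhom_add A B (f g : vhom A B) : vhom A B.
Proof.
apply: (@vhom_of A B (fun x => f x + g x)) => [a x y|v n w] /=.
  by rewrite !linearP scalerDr addrACA.
by rewrite !vhom_act actD.
Defined.

Lemma vhom_bijV A B (f : vhom A B) : bijective f ->
  exists g : vhom B A, cancel f g /\ cancel g f.
Proof.
move=> [g fK gK].
have ling : linear g by move=> a x y; rewrite -[RHS]fK linearP !gK.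
have actg v n w : g (act v n w) = act v n (g w) by rewrite -[RHS]fK vhom_act gK.
by exists (vhom_of ling actg).
Qed.

Lemma isomorphic_sym A B : isomorphic A B -> isomorphic B A.
Proof.
by move=> [f /vhom_bijV[g [fK gK]]]; exists g; exists f.
Qed.

(** Preimages under [f] are chosen pointwise; injectivity makes them unique, so the choice is linear
    and commutes with the action. *)
Lemma vhom_factor A B D (h : vhom D B) (f : vhom A B) :
  injective f -> range h `<=` range f ->
  exists k : vhom D A, forall x, f (k x) = h x.
Proof.
move=> injf hf.
have /choice[k kE] : forall x, exists y, f y = h x.
  by move=> x; have [|y _ <-] := hf (h x); [exists x|exists y].
have link : linear k by move=> a x y; apply: injf; rewrite linearP !kE linearP.
have actk v n w : k (act v n w) = act v n (k w).
  by apply: injf; rewrite vhom_act !kE vhom_act.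
by exists (vhom_of link actk).
Qed.

Lemma vhom_injP A B (f : vhom A B) :
  injective f <-> forall x, f x = 0 -> x = 0.
Proof.
split=> [injf x fx0|h x y fxy]; first by apply: injf; rewrite fx0 linear0.
by apply/eqP; rewrite -subr_eq0; apply/eqP/h; rewrite linearB fxy subrr.
Qed.

Lemma range_comp_surj A B D (f : vhom A B) (e : vhom D A) :
  range e = setT -> range (vhom_comp f e) = range f.
Proof.
move=> /seteqP[_ esurj]; apply/seteqP; split=> _ [x _ <-]; first by exists (e x).
by have [y _ <-] := esurj x I; exists y.
Qed.

(** Bijectivity turns into equations between homomorphisms, which a fully faithful additive functor
    reflects. *)
Lemma direct_sum2P A B M (f : vhom A M) (g : vhom B M) :
  bijective (fun ab : A * B => f ab.1 + g ab.2) <->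
  exists (p : vhom M A) (q : vhom M B),
    [/\ forall a, p (f a) = a, forall b, q (g b) = b,
        forall b, p (g b) = 0, forall a, q (f a) = 0 &
        forall x, f (p x) + g (q x) = x].
Proof.
split=> [[h hK Kh]|[p [q [pf qg pg qf fgK]]]]; last first.
  exists (fun x => (p x, q x)) => // -[a b] /=.
  by rewrite !linearD /= pf qg pg qf addr0 add0r.
have hE a b : h (f a + g b) = (a, b) by exact: (hK (a, b)).
have hxE x : x = f (h x).1 + g (h x).2 by rewrite -{1}[x]Kh.
have hP a x y : h (a *: x + y) =
    (a *: (h x).1 + (h y).1, a *: (h x).2 + (h y).2).
  by rewrite -hE !linearP {1}[x]hxE {1}[y]hxE scalerDr addrACA.
have hact v n x : h (act v n x) = (act v n (h x).1, act v n (h x).2).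
  by rewrite -hE !vhom_act -actD -hxE.
have linp : linear (fun x => (h x).1) by move=> a x y; rewrite hP.
have linq : linear (fun x => (h x).2) by move=> a x y; rewrite hP.
have actp v n x : (h (act v n x)).1 = act v n (h x).1 by rewrite hact.
have actq v n x : (h (act v n x)).2 = act v n (h x).2 by rewrite hact.
exists (vhom_of linp actp), (vhom_of linq actq); split=> /=.
- by move=> a; rewrite -[f a]addr0 -(linear0 g) hE.
- by move=> b; rewrite -[g b]add0r -(linear0 f) hE.
- by move=> b; rewrite -[g b]add0r -(linear0 f) hE.
- by move=> a; rewrite -[f a]addr0 -(linear0 g) hE.
- by move=> x; rewrite -hxE.
Qed.

End Homomorphisms.

(** * Additive autoequivalences of the category *)

(** Isolates the properties of [J ⊠ -] on which most of the statement rests. Homomorphisms are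
    compared pointwise, hence the separate field [fmap_ext]. *)
Record additive_equivalence (R : realType) (V : voa R) (C : vmodule V -> Prop) :=
  AdditiveEquivalence {
  fobj :> object C -> object C;
  fmap : forall A B : object C, vhom A B -> vhom (fobj A) (fobj B);
  fmap_ext : forall (A B : object C) (f g : vhom A B), f =1 g -> fmap f =1 fmap g;
  fmap_id : forall A : object C, fmap (vhom_id A) =1 idfun;
  fmap_comp : forall (A B D : object C) (g : vhom B D) (f : vhom A B),
    fmap (vhom_comp g f) =1 fmap g \o fmap f;
  fmap_add : forall (A B : object C) (f g : vhom A B) x,
    fmap (vhom_add f g) x = fmap f x + fmap g x;
  fmap_faithful : forall (A B : object C) (f g : vhom A B),
    fmap f =1 fmap g -> f =1 g;
  fmap_full : forall (A B : object C) (h : vhom (fobj A) (fobj B)),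
    exists f : vhom A B, fmap f =1 h;
  fobj_surj : forall N : object C,
    exists (A : object C) (e : vhom (fobj A) N), bijective e }.

Arguments fmap {R V C} F {A B} f : rename.
Arguments fmap_ext {R V C} F {A B} [f g] _ _ : rename.
Arguments fmap_id {R V C} F [A] _ : rename.
Arguments fmap_comp {R V C} F {A B D} g f _ : rename.
Arguments fmap_add {R V C} F {A B} f g x : rename.
Arguments fmap_faithful {R V C} F {A B} [f g] _ _ : rename.
Arguments fmap_full {R V C} F {A B} h : rename.

(** * Injectivity, surjectivity and exactness under an equivalence *)

Section Equivalence.
Variables (R : realType) (V : voa R) (C : vmodule V -> Prop).
Hypothesis HC : abelian_subcategory C.
Variable F : additive_equivalence C.
Implicit Types A B D M N L X : object C.

(** The inclusion of the kernel, itself an object of the category, is the decisive test map.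
    Injectivity thus becomes a categorical notion. *)
Lemma vhom_injPn A B (f : vhom A B) :
  injective f <-> forall X (h : vhom X A), (forall x, f (h x) = 0) ->
    forall x, h x = 0.
Proof.
split=> [/vhom_injP injf X h fh x|mono]; first exact: injf.
have [K [i [_ iE]]] := has_kernel HC f.
apply/vhom_injP => x fx0.
have : range i x by rewrite iE.
move=> [y _ <-]; apply: mono => z.
by have : range i (i z) by [exists z]; rewrite iE.
Qed.

(** The decisive test map is the projection to the cokernel, which vanishes exactly on [range f]. *)
Lemma vhom_surjPn A B (f : vhom A B) :
  range f = setT <-> forall X (h : vhom B X), (forall x, h (f x) = 0) ->
    forall x, h x = 0.
Proof.
split=> [/seteqP[_ fs] X h hf x|epi].
  by have [y _ <-] := fs x I.
have [Q [q [_ qE]]] := has_cokernel HC f.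
rewrite -qE; apply/seteqP; split=> // x _; apply: epi => y.
by have : range f (f y) by [exists y]; rewrite -qE.
Qed.

Lemma fmap_zero A B x : fmap F (vhom_zero A B) x = 0.
Proof.
have := fmap_add F (vhom_zero A B) (vhom_zero A B) x.
rewrite (@fmap_ext _ _ _ F _ _ _ (vhom_zero A B)) => [|y /=]; last exact: addr0.
by rewrite -[LHS]addr0 => /addrI.
Qed.

Lemma fmap_eq0 A B (f : vhom A B) :
  (forall x, fmap F f x = 0) <-> forall x, f x = 0.
Proof.
split=> [Ff0 x|f0 x].
  rewrite (@fmap_faithful _ _ _ F _ _ f (vhom_zero A B)) // => y.
  by rewrite fmap_zero.
by rewrite (@fmap_ext _ _ _ F _ _ f (vhom_zero A B)) // fmap_zero.
Qed.

(** Essential surjectivity replaces [X] by some [F B], and fullness then lifts the map. Tests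
    against arbitrary objects reduce in this way to tests in the image of [F]. *)
Lemma fmap_fullr A X (h : vhom (F A) X) :
  exists (B : object C) (e : vhom (F B) X) (f : vhom A B),
    bijective e /\ forall x, e (fmap F f x) = h x.
Proof.
have [B [e be]] := fobj_surj F X; have [g [eK gK]] := vhom_bijV be.
have [f fE] := fmap_full F (vhom_comp g h).
by exists B, e, f; split=> // x; rewrite fE /= gK.
Qed.

Lemma fmap_fulll A X (h : vhom X (F A)) :
  exists (B : object C) (e : vhom (F B) X) (f : vhom B A),
    bijective e /\ fmap F f =1 h \o e.
Proof.
have [B [e be]] := fobj_surj F X.
by have [f fE] := fmap_full F (vhom_comp h e); exists B, e, f.
Qed.

(** For reflection, [fmap F h] serves as test map. For preservation, [fmap_fulll] replaces any test
    map into [F A] by some [fmap F k], up to isomorphism. *)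
Lemma fmap_inj A B (f : vhom A B) : injective (fmap F f) <-> injective f.
Proof.
rewrite !vhom_injPn; split=> mono X h fh x.
  have /fmap_eq0 h0 : forall y, fmap F h y = 0.
    apply: mono => y; rewrite -[LHS](fmap_comp F f h).
    by move: y; apply/fmap_eq0.
  exact: h0.
have [D [e [k [[g _ gK] kE]]]] := fmap_fulll h.
rewrite -[x]gK -[LHS]kE; move: (g x).
apply/fmap_eq0/mono/(fmap_eq0 (vhom_comp f k)) => y.
by rewrite fmap_comp /= kE /= fh.
Qed.

Lemma fmap_surj A B (f : vhom A B) :
  range (fmap F f) = setT <-> range f = setT.
Proof.
rewrite !vhom_surjPn; split=> epi X h hf x.
  have /fmap_eq0 h0 : forall y, fmap F h y = 0.
    apply: epi => y; rewrite -[LHS](fmap_comp F h f).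
    by move: y; apply/fmap_eq0.
  exact: h0.
have [D [e [k [/bij_inj injE kE]]]] := fmap_fullr h.
rewrite -kE.
suff -> : fmap F k x = 0 by rewrite linear0.
move: x; apply/fmap_eq0/epi/(fmap_eq0 (vhom_comp k f)) => y.
by rewrite fmap_comp /=; apply: injE; rewrite kE hf linear0.
Qed.

(** A single kernel element is not a homomorphism, so the inclusion of the whole kernel of
    [fmap F g] is descended to some [h] with [g \o h] zero; [h] factors through [f], and [F] is
    applied to this factorization. *)
Lemma fmap_kernel A B D (f : vhom A B) (g : vhom B D) :
  injective f -> range f = [set y | g y = 0] ->
  range (fmap F f) = [set y | fmap F g y = 0].
Proof.
move=> injf fE; apply/seteqP; split=> [_ [x _ <-]|y gy0] /=.
  rewrite -[LHS](fmap_comp F g f); move: x; apply/fmap_eq0 => x /=.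
  by have : range f (f x) by [exists x]; rewrite fE.
have [K [i [_ iE]]] := has_kernel HC (fmap F g).
have {gy0} : range i y by rewrite iE.
move=> [z _ <-]; have [E [e [h [[e' _ eK] hE]]]] := fmap_fulll i.
have [x|k kE] := @vhom_factor _ _ _ _ _ h f injf.
  move=> [w _ <-] {x}; rewrite fE /=.
  move: w; apply/(fmap_eq0 (vhom_comp g h)) => w; rewrite fmap_comp /= hE /=.
  by have : range i (i (e w)) by [exists (e w)]; rewrite iE.
exists (fmap F k (e' z)) => //.
rewrite -[LHS](fmap_comp F f k) (fmap_ext F (g := h)) //.
by rewrite hE /= eK.
Qed.

Lemma fmap_short_exact A B D (f : vhom A B) (g : vhom B D) :
  short_exact f g -> short_exact (fmap F f) (fmap F g).
Proof.
move=> [injf fg surjg]; split; first exact/fmap_inj.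
  exact: fmap_kernel.
exact/fmap_surj.
Qed.

(** * The lattice of submodules under an equivalence *)

(** As [g] is injective, inclusion of ranges means that [f] factors through [g]; a fully faithful
    functor moves factorizations both ways. *)
Lemma fmap_range_sub A B M (f : vhom A M) (g : vhom B M) : injective g ->
  range (fmap F f) `<=` range (fmap F g) <-> range f `<=` range g.
Proof.
move=> injg; split=> [sFfg|sfg].
  have injFg : injective (fmap F g) by exact/fmap_inj.
  have [k kE] := vhom_factor injFg sFfg.
  have [h hE] := fmap_full F k.
  move=> _ [x _ <-]; exists (h x) => //.
  apply: (@fmap_faithful _ _ _ F _ _ (vhom_comp g h) f) => y.
  by rewrite fmap_comp /= hE kE.
have [k kE] := vhom_factor injg sfg.
move=> _ [x _ <-]; exists (fmap F k x) => //.
by rewrite -[LHS](fmap_comp F g k); apply: fmap_ext.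
Qed.

Lemma identifies_isomorphic A B M (f : vhom A M) (g : vhom B M) (P : set M) :
  identifies f P -> identifies g P -> isomorphic A B.
Proof.
move=> [injf fP] [injg gP].
have [|k kE] := @vhom_factor _ _ _ _ _ f g injg; first by rewrite fP gP.
have [|h hE] := @vhom_factor _ _ _ _ _ g f injf; first by rewrite fP gP.
by exists k; exists h => x; [apply: injf|apply: injg]; rewrite ?hE ?kE ?hE.
Qed.

(** The submodule of [F M] corresponding to [P]. A subset has no preferred representing object, so
    all are allowed; the result is empty if [P] is not a submodule. *)
Definition fsub M (P : set M) : set (F M) :=
  [set y | exists N (i : vhom N M), identifies i P /\ range (fmap F i) y].

Lemma fsubE M N (i : vhom N M) (P : set M) :
  identifies i P -> fsub P = range (fmap F i).
Proof.
move=> [injP iP]; apply/seteqP; split=> y; last by exists N, i.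
move=> [A [j [[injj jP]]]].
have /(_ y) : range (fmap F j) `<=` range (fmap F i); last exact.
by apply/fmap_range_sub => //; rewrite iP jP.
Qed.

Lemma fsub_identifies M N (i : vhom N M) (P : set M) :
  identifies i P -> identifies (fmap F i) (fsub P).
Proof.
by move=> iP; split; [apply/fmap_inj; case: iP|rewrite (fsubE iP)].
Qed.

Lemma submodule_fsub M (P : set M) : submodule P -> submodule (fsub P).
Proof. by move=> [N [i /fsub_identifies iP]]; exists (F N), (fmap F i). Qed.

(** Gives surjectivity of [fsub] onto the submodules of [F M]. The isomorphism [e] is kept because
    simplicity of a submodule refers to its representing object. *)
Lemma identifies_fsub M N (j : vhom N (F M)) (Q : set (F M)) :
  identifies j Q -> exists A (e : vhom (F A) N) (i : vhom A M) (P : set M),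
    [/\ bijective e, identifies i P, fmap F i =1 j \o e & Q = fsub P].
Proof.
move=> [injj jQ]; have [A [e [i [be iE]]]] := fmap_fulll j.
have injFi : injective (fmap F i).
  by move=> x y; rewrite !iE /= => /injj /(bij_inj be).
have idi : identifies i (range i) by split=> //; exact/fmap_inj.
exists A, e, i, (range i); split=> //.
rewrite (fsubE idi) -jQ -(range_comp_surj j (bij_surj be)).
by apply: eq_imagel => x _; rewrite iE.
Qed.

Lemma submodule_fsubP M (Q : set (F M)) :
  submodule Q -> exists2 P, submodule P & Q = fsub P.
Proof.
move=> [N [j /identifies_fsub[A [e [i [P [_ iP _ QP]]]]]]].
by exists P => //; exists A, i.
Qed.

(** Together with [submodule_fsubP], this makes [fsub] an isomorphism between the lattices of
    submodules. *)
Lemma fsub_le M (P P' : set M) : submodule P -> submodule P' ->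
  fsub P `<=` fsub P' <-> P `<=` P'.
Proof.
move=> [A [i iP]] [B [j jP]]; rewrite (fsubE iP) (fsubE jP) -iP.2 -jP.2.
by apply: fmap_range_sub; case: jP.
Qed.

Lemma fsub_eq M (P P' : set M) : submodule P -> submodule P' ->
  fsub P = fsub P' <-> P = P'.
Proof.
move=> sP sP'; split=> [/seteqP[h h']|->//].
by apply/seteqP; split; exact/fsub_le.
Qed.

Lemma identifies_setT M : identifies (vhom_id M) setT.
Proof. by split=> //; apply/seteqP; split=> // x _; exists x. Qed.

Lemma submoduleT M : submodule [set: M].
Proof. by exists M, (vhom_id M); exact: identifies_setT. Qed.

Lemma fsubT M : fsub [set: M] = setT.
Proof.
rewrite (fsubE (identifies_setT M)); apply/seteqP; split=> // y _.
by exists y => //; rewrite fmap_id.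
Qed.

Lemma nonzeroPn M : ~ nonzero M <-> forall x : M, x = 0.
Proof.
split=> [nz x|z [x]]; last by move/(_ (z x)).
by apply: contrapT => x0; apply: nz; exists x.
Qed.

(** An object is zero exactly when its identity is the zero map, and [F] preserves and reflects zero
    maps. *)
Lemma nonzero_fobj M : nonzero (F M) <-> nonzero M.
Proof.
suff : ~ nonzero (F M) <-> ~ nonzero M.
  by move=> [h h']; split=> nz; apply: contrapT; [move/h'|move/h].
rewrite !nonzeroPn; split=> z.
  by apply/(fmap_eq0 (vhom_id M)) => y; rewrite fmap_id; exact: z.
move=> x; rewrite -[x](fmap_id F (A := M)); move: x.
exact/(fmap_eq0 (vhom_id M)).
Qed.

Lemma identifies_set0 M : exists (Z : object C) (i : vhom Z M),
  identifies i [set 0] /\ forall z : Z, z = 0.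
Proof.
have [Z z0] := has_zero HC; exists Z, (vhom_zero Z M); split=> //.
split=> [x y _|]; first by rewrite [x]z0 [y]z0.
by apply/seteqP; split=> [_ [x _ <-] //|_ ->]; exists 0.
Qed.

Lemma submodule0 M : submodule [set 0 : M].
Proof. by have [Z [i [iP _]]] := identifies_set0 M; exists Z, i. Qed.

Lemma fsub0 M : fsub [set 0 : M] = [set 0].
Proof.
have [Z [i [iP z0]]] := identifies_set0 M; rewrite (fsubE iP).
have Fz0 : forall z : F Z, z = 0.
  by apply/nonzeroPn => /nonzero_fobj; apply/nonzeroPn.
apply/seteqP; split=> [_ [x _ <-]|_ ->]; first by rewrite [x]Fz0 linear0.
by exists 0; rewrite ?linear0.
Qed.

(** * Simple objects, maximal and simple submodules, radical and socle *)

Lemma simple_iso A B : isomorphic A B -> simple A -> simple B.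
Proof.
move=> [e be] [[a a0] sA]; have [e' [eK e'K]] := vhom_bijV be.
split=> [|P [N [i [inji iP]]]].
  by exists (e a) => ea0; apply: a0; rewrite -[a]eK ea0 linear0.
have /sA : submodule (range (vhom_comp e' i)).
  by exists N, (vhom_comp e' i); split=> // x y /= /(can_inj e'K)/inji.
move=> [] /seteqP[h h']; [left|right]; rewrite -iP; apply/seteqP; split=> //.
- move=> _ [x _ <-]; have : range (vhom_comp e' i) (e' (i x)) by exists x.
  by move=> /h /= ei0; rewrite -[LHS]e'K ei0 linear0.
- by move=> _ ->; exists 0; rewrite ?linear0.
- move=> x _; have [y _ yx] := h' (e' x) I; exists y => //.
  exact: (can_inj e'K).
Qed.

Lemma simple_fobj M : simple (F M) <-> simple M.
Proof.
split=> -[/nonzero_fobj nz sM]; split=> // P sP.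
  have [|] := sM _ (submodule_fsub sP).
    by rewrite -fsub0 => /(fsub_eq sP (submodule0 M)); left.
  by rewrite -fsubT => /(fsub_eq sP (submoduleT M)); right.
have [P' sP' ->] := submodule_fsubP sP.
by have [->|->] := sM P' sP'; [left; exact: fsub0|right; exact: fsubT].
Qed.

Lemma maximal_fsub M (P : set M) : submodule P ->
  maximal_submodule (fsub P) <-> maximal_submodule P.
Proof.
move=> sP; have sT := submoduleT M.
split=> -[_ PT mP]; split=> //; try exact: submodule_fsub.
- by move=> PT'; apply: PT; rewrite PT' fsubT.
- move=> Q sQ PQ; have [| | |] := mP (fsub Q).
  + exact: submodule_fsub.
  + exact/fsub_le.
  + by move=> /(fsub_eq sQ sP); left.
  + by rewrite -fsubT => /(fsub_eq sQ sT); right.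
- by rewrite -fsubT => /(fsub_eq sP sT).
move=> _ /submodule_fsubP[Q sQ ->] /(fsub_le sP sQ) PQ.
by have [->|->] := mP Q sQ PQ; [left|right; exact: fsubT].
Qed.

Lemma simple_submodule_sub M (P : set M) : simple_submodule P -> submodule P.
Proof. by move=> [N [i [_ iP]]]; exists N, i. Qed.

(** The object representing a simple submodule of [F M] is brought to the form [F A] by an
    isomorphism, and simplicity then descends to [A]. *)
Lemma simple_fsub M (P : set M) : submodule P ->
  simple_submodule (fsub P) <-> simple_submodule P.
Proof.
move=> sP; split=> [[N [j [sN jP]]]|[N [i [sN iP]]]]; last first.
  exists (F N), (fmap F i); split; first exact/simple_fobj.
  exact: fsub_identifies.
have [A [e [i [P' [be iP' _ PP']]]]] := identifies_fsub jP.
have {}PP' : P = P' by apply/fsub_eq => //; exists A, i.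
exists A, i; split; last by rewrite PP'.
apply/simple_fobj; apply: simple_iso sN.
by apply: isomorphic_sym; exists e.
Qed.

(** The defining bounds involve only inclusions of submodules and maximality, which [fsub] preserves
    and reflects. *)
Lemma radical_fsub M (P : set M) : radical P -> radical (fsub P).
Proof.
move=> [sP lP gP]; split; first exact: submodule_fsub.
  move=> Q' mQ; have [/submodule_fsubP[Q sQ QE] _ _] := mQ.
  move: mQ; rewrite QE => /(maximal_fsub sQ) mQ.
  by apply/fsub_le => //; exact: lP.
move=> _ /submodule_fsubP[P' sP' ->] h; apply/fsub_le => //; apply: gP => // Q mQ.
have [sQ _ _] := mQ.
by apply/fsub_le => //; apply: h; apply/maximal_fsub.
Qed.

Lemma socle_fsub M (P : set M) : socle P -> socle (fsub P).
Proof.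
move=> [sP gP lP]; split; first exact: submodule_fsub.
  move=> Q' mQ; have /submodule_fsubP[Q sQ QE] := simple_submodule_sub mQ.
  move: mQ; rewrite QE => /(simple_fsub sQ) mQ.
  by apply/fsub_le => //; exact: gP.
move=> _ /submodule_fsubP[P' sP' ->] h; apply/fsub_le => //; apply: lP => // Q mQ.
have sQ := simple_submodule_sub mQ.
by apply/fsub_le => //; apply: h; apply/simple_fsub.
Qed.

Lemma radical_uniq M (P P' : set M) : radical P -> radical P' -> P = P'.
Proof.
by move=> [sP lP gP] [sP' lP' gP']; apply/seteqP; split; [apply: gP'|apply: gP].
Qed.

Lemma socle_uniq M (P P' : set M) : socle P -> socle P' -> P = P'.
Proof.
by move=> [sP gP lP] [sP' gP' lP']; apply/seteqP; split; [apply: lP|apply: lP'].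
Qed.

(** The radical is unique as a subset, so [N'] and [F N] represent the same submodule of [F M]. *)
Lemma is_radical_fobj M N : is_radical M N ->
  (exists N', is_radical (F M) N') /\
  (forall N', is_radical (F M) N' -> isomorphic N' (F N)).
Proof.
move=> [P [i [/radical_fsub rP /fsub_identifies iP]]]; split.
  by exists (F N), (fsub P), (fmap F i).
move=> N' [Q [j [rQ jQ]]]; rewrite (radical_uniq rQ rP) in jQ.
exact: identifies_isomorphic jQ iP.
Qed.

Lemma is_socle_fobj M N : is_socle M N ->
  (exists N', is_socle (F M) N') /\
  (forall N', is_socle (F M) N' -> isomorphic N' (F N)).
Proof.
move=> [P [i [/socle_fsub rP /fsub_identifies iP]]]; split.
  by exists (F N), (fsub P), (fmap F i).
move=> N' [Q [j [rQ jQ]]]; rewrite (socle_uniq rQ rP) in jQ.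
exact: identifies_isomorphic jQ iP.
Qed.

(** * Images, kernels, preimages, subquotients and composition series *)

Lemma identifies_image A N M (i : vhom N M) (j : vhom A N) (P : set N) :
  injective i -> identifies j P -> identifies (vhom_comp i j) (i @` P).
Proof.
move=> inji [injj <-]; split=> [x y /= /inji/injj//|].
by rewrite image_comp.
Qed.

(** Serves radical series, where the radical is formed inside the object [N] representing a term and
    is then carried into [M]. *)
Lemma fsub_image N M (i : vhom N M) (P : set N) : injective i -> submodule P ->
  fsub (i @` P) = fmap F i @` fsub P.
Proof.
move=> inji [A [j jP]]; rewrite (fsubE (identifies_image inji jP)) (fsubE jP).
rewrite image_comp; congr (_ @` _); apply/funext => x; exact: fmap_comp.
Qed.

Lemma fsub_kernel A B (g : vhom A B) :
  fsub [set x | g x = 0] = [set y | fmap F g y = 0].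
Proof.
have [K [k [injk kE]]] := has_kernel HC g.
have idk : identifies k [set x | g x = 0] by [].
by rewrite (fsubE idk); exact: fmap_kernel.
Qed.

(* The preimage of [P] is the kernel of the composite [M -> Q -> Q / P]. *)
Lemma fsub_preimage M N (q : vhom M N) (P : set N) : submodule P ->
  fsub (q @^-1` P) = fmap F q @^-1` fsub P.
Proof.
move=> [A [i [inji <-]]]; have [Q [c [_ cE]]] := has_cokernel HC i.
rewrite -cE (fsub_kernel c).
rewrite (_ : q @^-1` _ = [set x | vhom_comp c q x = 0]) // fsub_kernel.
by apply/seteqP; split=> y /=; rewrite fmap_comp.
Qed.

Lemma subquotient_sub M (P Q : set M) L : subquotient P Q L ->
  submodule P /\ submodule Q.
Proof. by move=> [sP [_ [N [i [q [iQ _ _]]]]]]; split=> //; exists N, i. Qed.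

Lemma subquotient_fsub M (P Q : set M) L : subquotient P Q L ->
  subquotient (fsub P) (fsub Q) (F L).
Proof.
move=> sPQ; have [sP sQ] := subquotient_sub sPQ.
move: sPQ => [_ [PQ [N [i [q [iQ sq qP]]]]]].
split; first exact: submodule_fsub.
split; first exact/fsub_le.
exists (F N), (fmap F i), (fmap F q); split.
- exact: fsub_identifies.
- exact/fmap_surj.
(* Since [fsub] commutes with kernels and with preimages, the condition on [fmap F q] reduces to the
   equality of the kernel of [q] and the preimage of [P]. *)
move=> x; have -> : fmap F q x = 0 <-> fsub [set y | q y = 0] x.
  by rewrite fsub_kernel.
have -> : [set y | q y = 0] = i @^-1` P by apply/seteqP; split=> y /qP.
by rewrite fsub_preimage.
Qed.

Lemma composition_series_fobj M n (S : 'I_n -> object C) :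
  composition_series M S -> composition_series (F M) (fun i => F (S i)).
Proof.
move=> [sS [G [G0 Gn GS]]]; split=> [i|]; first exact/simple_fobj.
exists (fun k => fsub (G k)); split; rewrite ?G0 ?Gn ?fsub0 ?fsubT // => i.
exact: subquotient_fsub.
Qed.

(** * Direct sums, Loewy layers, radical and socle series *)

(** With [X] replaced by an isomorphic [F B], fullness lifts the maps [g i] to maps into [B], where
    the universal property applies; uniqueness descends by faithfulness. *)
Lemma direct_sum_fobj (I : Type) (S : I -> object C) M :
  is_direct_sum S M -> is_direct_sum (fun i => F (S i)) (F M).
Proof.
move=> [f univ]; exists (fun i => fmap F (f i)) => X g.
have [B [e be]] := fobj_surj F X; have [e' [eK e'K]] := vhom_bijV be.
pose g' i := projT1 (cid (fmap_full F (vhom_comp e' (g i)))).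
have g'E i : fmap F (g' i) =1 e' \o g i := projT2 (cid (fmap_full F _)).
have [h [hf hu]] := univ B g'.
exists (vhom_comp e (fmap F h)); split.
  move=> i x /=; rewrite -[fmap F h _](fmap_comp F h (f i)).
  by rewrite (fmap_ext F (f := vhom_comp h (f i)) (hf i)) g'E /= e'K.
move=> h' h'f x /=; have [k kE] := fmap_full F (vhom_comp e' h').
have kh : k =1 h.
  apply: hu => i; apply: (@fmap_faithful _ _ _ F _ _ (vhom_comp k (f i))) => y.
  by rewrite fmap_comp /= kE g'E /= -h'f.
by rewrite -(fmap_ext F kh) kE /= e'K.
Qed.

Lemma semisimple_layer_fsub M (P Q : set M) (I : Type) (S : I -> object C) :
  semisimple_layer P Q S ->
  semisimple_layer (fsub P) (fsub Q) (fun i => F (S i)).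
Proof.
move=> [sS [L [sL dL]]]; split=> [i|]; first exact/simple_fobj.
exists (F L); split; first exact: subquotient_fsub.
exact: direct_sum_fobj.
Qed.

Lemma radical_series_fsub M (G : nat -> set M) : radical_series G ->
  radical_series (fun k => fsub (G k)).
Proof.
move=> [G0 Gr]; split=> [|k]; first by rewrite G0 fsubT.
have [N [i [P [iG rP ->]]]] := Gr k.
exists (F N), (fmap F i), (fsub P); split.
- exact: fsub_identifies.
- exact: radical_fsub.
- by apply: fsub_image; [case: iG|case: rP].
Qed.

Lemma radical_series_sub M (G : nat -> set M) k :
  radical_series G -> submodule (G k).
Proof. by move=> [_ /(_ k)[N [i [P [iG _ _]]]]]; exists N, i. Qed.

Lemma socle_series_fsub M (G : nat -> set M) : socle_series G ->
  socle_series (fun k => fsub (G k)).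
Proof.
move=> [G0 Gs]; split=> [|k]; first by rewrite G0 fsub0.
have [Q [q [P [sq qG sP ->]]]] := Gs k.
exists (F Q), (fmap F q), (fsub P); split.
- exact/fmap_surj.
- by rewrite -qG fsub_kernel.
- exact: socle_fsub.
- by apply: fsub_preimage; case: sP.
Qed.

(** Each term is the kernel of the projection used to form the next one. *)
Lemma socle_series_sub M (G : nat -> set M) k :
  socle_series G -> submodule (G k).
Proof.
move=> [_ /(_ k)[Q [q [P [_ <- _ _]]]]].
by have [K [i [inji iE]]] := has_kernel HC q; exists K, i.
Qed.

(** Shows that corresponding radical series reach zero at the same index; [fsub_eqT] does the same
    for socle series and the whole module. *)
Lemma fsub_eq0 M (P : set M) : submodule P -> P = [set 0] <-> fsub P = [set 0].
Proof. by move=> sP; rewrite -(fsub0 M) fsub_eq //; exact: submodule0. Qed.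

Lemma fsub_eqT M (P : set M) : submodule P -> P = setT <-> fsub P = setT.
Proof. by move=> sP; rewrite -(fsubT M) fsub_eq //; exact: submoduleT. Qed.

(** * Indecomposability *)

(** A decomposition of [F M], written as equations between inclusions and projections, is lifted to
    [M] by fullness and verified there by faithfulness. *)
Lemma indecomposable_fobj M : indecomposable M -> indecomposable (F M).
Proof.
move=> [/nonzero_fobj nzM indM]; split=> // A B [f [g]].
move=> /direct_sum2P[p [q [pf qg pg qf fgK]]].
have [A' [a [f' [ba f'E]]]] := fmap_fulll f.
have [B' [b [g' [bb g'E]]]] := fmap_fulll g.
have [a' [aK a'K]] := vhom_bijV ba; have [b' [bK b'K]] := vhom_bijV bb.
(* The inclusions were lifted up to the isomorphisms [a] and [b], so the projections are corrected
   by the inverses. *)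
have [p' p'E] := fmap_full F (vhom_comp a' p).
have [q' q'E] := fmap_full F (vhom_comp b' q).
have dM : is_direct_sum2 A' B' M.
  exists f', g'; apply/direct_sum2P; exists p', q'; split.
  - apply: (@fmap_faithful _ _ _ F _ _ (vhom_comp p' f') (vhom_id _)) => x.
    by rewrite fmap_comp fmap_id /= p'E f'E /= pf aK.
  - apply: (@fmap_faithful _ _ _ F _ _ (vhom_comp q' g') (vhom_id _)) => x.
    by rewrite fmap_comp fmap_id /= q'E g'E /= qg bK.
  - apply/(fmap_eq0 (vhom_comp p' g')) => x.
    by rewrite fmap_comp /= p'E g'E /= pg linear0.
  - apply/(fmap_eq0 (vhom_comp q' f')) => x.
    by rewrite fmap_comp /= q'E f'E /= qf linear0.
  - apply: (@fmap_faithful _ _ _ F _ _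
      (vhom_add (vhom_comp f' p') (vhom_comp g' q')) (vhom_id _)) => x.
    by rewrite fmap_add !fmap_comp fmap_id /= f'E g'E /= p'E q'E /= a'K b'K fgK.
have iso0 X Y (e : vhom (F X) Y) : bijective e -> ~ nonzero X -> ~ nonzero Y.
  move=> /vhom_bijV[e' [eK e'K]] nX [y]; apply.
  have /nonzeroPn FX0 : ~ nonzero (F X) by move/nonzero_fobj.
  by rewrite -[y]e'K [e' y]FX0 linear0.
by have [nz|nz] := indM _ _ dM;
  [left; apply: iso0 ba nz|right; apply: iso0 bb nz].
Qed.

End Equivalence.

(** * Fusion with a simple current as an equivalence *)

Section SimpleCurrent.
Variables (R : realType) (V : voa R) (C : module_category V).
Implicit Types A B D J : object C.

Let Fus := category_fusion C.
Let Br := category_braided C.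

(** Uniqueness in the universal property: a homomorphism out of [A ⊠ B] is determined on the modes
    of the universal intertwining operator. Functoriality and additivity follow from this. *)
Lemma fusion_map_uniq A B A' B' (f : vhom A A') (g : vhom B B')
    (h : vhom (A ⊠ B) (A' ⊠ B')) :
  (forall a n k b, h (fusY Fus A B a n k b) = fusY Fus A' B' (f a) n k (g b)) ->
  fusion_map f g =1 h.
Proof.
by move=> hE x; rewrite (fus_lift_uniq (Y := precomp f g (fusY Fus A' B')) hE).
Qed.

Lemma fusion_mapE A B A' B' (f : vhom A A') (g : vhom B B') a n k b :
  fusion_map f g (fusY Fus A B a n k b) = fusY Fus A' B' (f a) n k (g b).
Proof. by rewrite /fusion_map /fus_map fus_liftE. Qed.

Lemma fusion_map_ext A B A' B' (f f' : vhom A A') (g g' : vhom B B') :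
  f =1 f' -> g =1 g' -> fusion_map f g =1 fusion_map f' g'.
Proof.
by move=> ff gg; apply: fusion_map_uniq => a n k b; rewrite fusion_mapE ff gg.
Qed.

Lemma fusion_map_id A B : fusion_map (vhom_id A) (vhom_id B) =1 idfun.
Proof. exact: (fusion_map_uniq (h := vhom_id (A ⊠ B))). Qed.

Lemma fusion_map_comp A B A' B' A'' B'' (f' : vhom A' A'') (f : vhom A A')
    (g' : vhom B' B'') (g : vhom B B') :
  fusion_map (vhom_comp f' f) (vhom_comp g' g) =1
  fusion_map f' g' \o fusion_map f g.
Proof.
apply: (fusion_map_uniq (h := vhom_comp (fusion_map f' g') (fusion_map f g))).
by move=> a n k b /=; rewrite !fusion_mapE.
Qed.

Lemma fusion_map_addr A B A' B' (f : vhom A A') (g g' : vhom B B') x :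
  fusion_map f (vhom_add g g') x = fusion_map f g x + fusion_map f g' x.
Proof.
apply: (fusion_map_uniq (h := vhom_add (fusion_map f g) (fusion_map f g'))).
move=> a n k b /=; rewrite !fusion_mapE.
by have := opr_linr (fusY Fus A' B') (f a) n k 1 (g b) (g' b); rewrite !scale1r.
Qed.

Lemma fusion_map_bij A B A' B' (f : vhom A A') (g : vhom B B') :
  bijective f -> bijective g -> bijective (fusion_map f g).
Proof.
move=> /vhom_bijV[f' [fK f'K]] /vhom_bijV[g' [gK g'K]].
exists (fusion_map f' g') => x; rewrite -[LHS]fusion_map_comp.
  by rewrite (fusion_map_ext (f' := vhom_id A) (g' := vhom_id B)) ?fusion_map_id.
by rewrite (fusion_map_ext (f' := vhom_id A') (g' := vhom_id B')) ?fusion_map_id.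
Qed.

(** [eta A] is the composite of the inverse associator, the map induced by [J ⊠ J' ≅ V], and the
    left unit isomorphism. *)
Lemma fusion_cancel J J' : isomorphic (J ⊠ J') (unit_object C) ->
  exists eta : forall A, vhom (J ⊠ (J' ⊠ A)) A,
    (forall A, bijective (eta A)) /\
    forall A B (f : vhom A B) x,
      eta B (fusion_map (vhom_id J) (fusion_map (vhom_id J') f) x) = f (eta A x).
Proof.
move=> [e be].
exists (fun A => vhom_comp (lunit Br A)
  (vhom_comp (fusion_map e (vhom_id A)) (assocV Br J J' A))); split.
  move=> A; apply: bij_comp; first exact: lunit_iso.
  apply: bij_comp; last first.
    by exists (assoc Br J J' A); [exact: assocVK|exact: assocK].
  by apply: fusion_map_bij => //; exists id.
(* Naturality is given for [assoc], so [x] is written as the image under [assoc] of some [y]. *)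
move=> A B f x /=; rewrite -[x in LHS](assocVK Br).
move: (assocV Br J J' A x) => y.
have := assoc_nat Br (vhom_id J) (vhom_id J') f y => /= E.
have -> : fusion_map (vhom_id J) (fusion_map (vhom_id J') f)
    (assoc Br J J' A y) =
  assoc Br J J' B (fusion_map (fusion_map (vhom_id J) (vhom_id J')) f y).
  exact: (esym E).
(* Once [f] has passed through the left unit, [e] and [f] act on different factors, and
   functoriality in both arguments lets them commute. *)
rewrite (assocK Br) -[RHS](lunit_nat Br f) /=; congr (lunit Br B _).
rewrite -[LHS]fusion_map_comp -[RHS]fusion_map_comp.
by apply: fusion_map_ext => z //=; rewrite fusion_map_id.
Qed.

(** The natural isomorphism [J' ⊠ (J ⊠ A) ≅ A] recovers [f] from its fusion with [J]. *)
Lemma fusion_faithful J J' : isomorphic (J' ⊠ J) (unit_object C) ->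
  forall A B (f g : vhom A B),
  fusion_map (vhom_id J) f =1 fusion_map (vhom_id J) g -> f =1 g.
Proof.
move=> /fusion_cancel[eta [beta nat]] A B f g fg x.
have [eta' etaK eta'K] := beta A.
by rewrite -[x]eta'K -!nat; congr (eta B _); exact: fusion_map_ext.
Qed.

(** The lift is the fusion of [J'] with [h], conjugated by [eta]. That it maps to [h] is checked
    after fusing with [J'], which is faithful too. *)
Lemma fusion_full J J' : isomorphic (J' ⊠ J) (unit_object C) ->
  isomorphic (J ⊠ J') (unit_object C) ->
  forall A B (h : vhom (J ⊠ A) (J ⊠ B)), exists f : vhom A B,
  fusion_map (vhom_id J) f =1 h.
Proof.
move=> J'J JJ' A B h; have [eta [beta nat]] := fusion_cancel J'J.
have [eta' [etaK eta'K]] := vhom_bijV (beta A).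
exists (vhom_comp (eta B) (vhom_comp (fusion_map (vhom_id J') h) eta')).
apply: (fusion_faithful JJ') => x; apply: (bij_inj (beta B)).
by rewrite nat /= etaK.
Qed.

(** Kept transparent so that [F A] computes to [J ⊠ A] and the general results apply by conversion.
    A preimage of [N] up to isomorphism is [J' ⊠ N]. *)
Definition simple_current_equivalence J (hJ : simple_current J) :
  additive_equivalence C.
Proof.
apply: (@AdditiveEquivalence _ _ _ (fun A => J ⊠ A)
  (fun A B f => fusion_map (vhom_id J) f)).
- by move=> A B f g fg; exact: fusion_map_ext.
- by move=> A; exact: fusion_map_id.
- move=> A B D g f x; rewrite -[RHS]fusion_map_comp; exact: fusion_map_ext.
- by move=> A B f g x; exact: fusion_map_addr.
- have [J' [JJ' /isomorphic_sym J'J]] := hJ; exact: fusion_faithful J'J.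
- have [J' [JJ' /isomorphic_sym J'J]] := hJ; exact: fusion_full J'J JJ'.
- have [J' [JJ' J'J]] := hJ; have [eta [beta _]] := fusion_cancel JJ'.
  by move=> N; exists (J' ⊠ N), (eta N).
Defined.

(** * Exactness of fusion on the other side *)

Lemma short_exact_iso (A B D A' B' D' : object C) (a : vhom A A')
    (b : vhom B B') (d : vhom D D') (f : vhom A B) (g : vhom B D)
    (f' : vhom A' B') (g' : vhom B' D') :
  bijective a -> bijective b -> bijective d ->
  (forall x, b (f x) = f' (a x)) -> (forall x, d (g x) = g' (b x)) ->
  short_exact f g -> short_exact f' g'.
Proof.
move=> [a' aK a'K] [b' bK b'K] bd bf dg [injf fg surjg].
have [d' dK d'K] := bd.
split.
- move=> x y; rewrite -[x]a'K -[y]a'K -!bf => /(can_inj bK)/injf /(congr1 a).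
  by [].
- apply/seteqP; split=> [_ [x _ <-]|y] /=.
    rewrite -[x]a'K -bf -dg; have : range f (f (a' x)) by exists (a' x).
    by rewrite fg /= => ->; rewrite linear0.
  rewrite -[y]b'K -dg -(linear0 d) => /(can_inj dK) gy0.
  have : range f (b' y) by rewrite fg.
  by move=> [x _ <-]; exists (a x); rewrite // -bf.
- apply/seteqP; split=> // y _.
  have : range g (d' y) by rewrite surjg.
  by move=> [x _ xE]; exists (b x); rewrite // -dg xE d'K.
Qed.

(** The braiding isomorphisms [J ⊠ A -> A ⊠ J] are natural, so they carry one short exact sequence
    to the other. *)
Lemma short_exact_fusionr J : (forall A B D (f : vhom A B) (g : vhom B D),
    short_exact f g ->
    short_exact (fusion_map (vhom_id J) f) (fusion_map (vhom_id J) g)) ->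
  forall A B D (f : vhom A B) (g : vhom B D), short_exact f g ->
    short_exact (fusion_map f (vhom_id J)) (fusion_map g (vhom_id J)).
Proof.
move=> exJ A B D f g /exJ; apply: short_exact_iso; try exact: (braid_iso Br J).
- exact: (braid_nat Br (vhom_id J) f).
- exact: (braid_nat Br (vhom_id J) g).
Qed.

End SimpleCurrent.

Theorem proposition2p5 (R : realType) (V : voa R) (C : module_category V)
    (J : object C) (hJ : simple_current J) :
  (* (1) *)
  (forall M : object C, nonzero M -> nonzero (J ⊠ M)) /\
  (* (2) *)
  (forall M : object C, indecomposable M -> indecomposable (J ⊠ M)) /\
  (* (3) *)
  ((forall M : object C, simple M -> simple (J ⊠ M)) /\
   (simple (unit_object C) -> simple J)) /\
  (* (4) *)
  ((forall (A B D : object C) (f : vhom A B) (g : vhom B D),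
      short_exact f g ->
      short_exact (fusion_map (vhom_id J) f) (fusion_map (vhom_id J) g)) /\
   (forall (A B D : object C) (f : vhom A B) (g : vhom B D),
      short_exact f g ->
      short_exact (fusion_map f (vhom_id J)) (fusion_map g (vhom_id J)))) /\
  (* (5) *)
  (forall (M : object C) (n : nat) (S : 'I_n -> object C),
     composition_series M S ->
     composition_series (J ⊠ M) (fun i => J ⊠ S i)) /\
  (* (6) *)
  ((forall M N : object C, is_radical M N ->
      (exists N', is_radical (J ⊠ M) N') /\
      (forall N', is_radical (J ⊠ M) N' -> isomorphic N' (J ⊠ N))) /\
   (forall M N : object C, is_socle M N ->
      (exists N', is_socle (J ⊠ M) N') /\
      (forall N', is_socle (J ⊠ M) N' -> isomorphic N' (J ⊠ N)))) /\
  (* (7) *)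
  ((forall (M : object C) (F : nat -> set M), radical_series F ->
      exists G : nat -> set (J ⊠ M),
        [/\ radical_series G,
            (forall n, F n = [set 0] <-> G n = [set 0]) &
            forall (I : nat -> Type) (D : forall k, I k -> object C),
              radical_loewy_diagram F D ->
              radical_loewy_diagram G (fun k i => J ⊠ D k i)]) /\
   (forall (M : object C) (F : nat -> set M), socle_series F ->
      exists G : nat -> set (J ⊠ M),
        [/\ socle_series G,
            (forall n, F n = setT <-> G n = setT) &
            forall (I : nat -> Type) (D : forall k, I k -> object C),
              socle_loewy_diagram F D ->
              socle_loewy_diagram G (fun k i => J ⊠ D k i)])).
Proof.
have HC := category_abelian C.
pose F := simple_current_equivalence hJ.
have exJ (A B D : object C) (f : vhom A B) (g : vhom B D) : short_exact f g ->
    short_exact (fusion_map (vhom_id J) f) (fusion_map (vhom_id J) g).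
  exact: (fmap_short_exact HC F).
split; first by move=> M /(nonzero_fobj F M).
split; first exact: (indecomposable_fobj F).
split.
  have sJ M : simple M -> simple (J ⊠ M) by move=> /(simple_fobj HC F).
  (* Simplicity of [J ⊠ V] passes to [J] along the right unit isomorphism. *)
  split=> // /sJ; apply: simple_iso.
  by exists (runit (category_braided C) J); exact: runit_iso.
split; first by split=> //; exact: short_exact_fusionr.
split; first exact: (composition_series_fobj HC F).
split.
  split; first exact: (is_radical_fobj HC F).
  exact: (is_socle_fobj HC F).
(* Both kinds of series are transported term by term through the isomorphism of lattices. *)
split=> M G hG; exists (fun k => fsub (F := F) (G k)); split.
- exact: (radical_series_fsub HC F).
- by move=> n; apply: (fsub_eq0 HC F); exact: radical_series_sub.
- by move=> I D hD k; exact: (semisimple_layer_fsub HC F).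
- exact: (socle_series_fsub HC F).
- by move=> n; apply: (fsub_eqT HC F); exact: (socle_series_sub HC n hG).
- by move=> I D hD k; exact: (semisimple_layer_fsub HC F).
Qed.
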